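(* Any infinite-dimensional Banach space $E$ contains a subspace with a basis such that either the basis is tight with constants or the subspace is locally minimal.
   Context: All Banach spaces are real and infinite-dimensional, and ''subspace'' means infinite-dimensional closed subspace unless said to be finite-dimensional. $\mathbb N=\{0,1,2,\ldots\}$, $[x_n\mid n\in A]$ is the closed linear span, ''basis'' means Schauder basis. $X\sqsubseteq_K Y$ means that there is an isomorphic embedding $T$ of $X$ into $Y$ with $\|T\|\cdot\|T^{-1}\|\le K$ (embedding with constant $K$). A basis $(e_n)$ is tight with constants if for every infinite-dimensional Banach space $Y$ there are successive non-empty intervals $I_0<I_1<I_2<\ldots$ of $\mathbb N$ such that $Y\not\sqsubseteq_K[e_n\mid n\notin I_K]$ for every integer constant $K$. $X$ is $K$-crudely finitely representable in $Y$ if every finite-dimensional subspace of $X$ embeds with constant $K$ into $Y$. A space $X$ is locally minimal if for some constant $K$, $X$ is $K$-crudely finitely representable in every one of its (infinite-dimensional) subspaces. *)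

(* Defs.v *)
(* Real Banach spaces are [completeNormedModType R] with [R : realType]. *)
From HB Require Import structures.
From mathcomp Require Import all_boot all_order all_algebra.
From mathcomp Require Import all_classical all_reals all_analysis.

Set Implicit Arguments.
Unset Strict Implicit.
Unset Printing Implicit Defensive.

Import Order.TTheory GRing.Theory Num.Theory.
Import numFieldNormedType.Exports.

Local Open Scope classical_set_scope.
Local Open Scope ring_scope.

(* Subspaces of a normed space [V] are represented as sets [A : set V], so that
   [setT : set V] stands for the whole space. *)

Definition linear_span (R : realType) (V : normedModType R) (S : set V) :
    set V :=
  [set x | exists (n : nat) (c : 'I_n -> R) (v : 'I_n -> V),
     (forall i, S (v i)) /\ x = \sum_(i < n) c i *: v i].

Definition closed_span (R : realType) (V : normedModType R) (S : set V) :
    set V :=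
  closure (linear_span S).

Definition finite_dim (R : realType) (V : normedModType R) (A : set V) : Prop :=
  exists s : seq V, A = linear_span [set` s].

Definition fin_dim_subspace (R : realType) (V : normedModType R) (A : set V) :
    Prop :=
  submod_closed (mem A) /\ finite_dim A.

Definition inf_dim_subspace (R : realType) (V : normedModType R) (A : set V) :
    Prop :=
  [/\ submod_closed (mem A), closed A & ~ finite_dim A].

Definition schauder_basis (R : realType) (V : normedModType R)
    (X : set V) (e : nat -> V) : Prop :=
  (forall n, X (e n)) /\
  (forall x, X x ->
     exists! a : nat -> R, series (fun n => a n *: e n) @ \oo --> x).

Definition linear_on (R : realType) (V W : normedModType R)
    (A : set V) (T : V -> W) : Prop :=
  forall (c : R) (x y : V), A x -> A y -> T (c *: x + y) = c *: T x + T y.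

Definition opnorm (R : realType) (V W : normedModType R)
    (A : set V) (T : V -> W) : \bar R :=
  ereal_sup [set `|T x|%:E | x in [set x | A x /\ `|x| <= 1]].

(* [A] embeds into [B] with constant [K]; [T] and [Tinv] only matter on [A] and
   on [T @` A], respectively. *)
Definition embeds (R : realType) (V W : normedModType R) (K : R)
    (A : set V) (B : set W) : Prop :=
  exists (T : V -> W) (Tinv : W -> V),
    [/\ linear_on A T,
        T @` A `<=` B,
        (forall x, A x -> Tinv (T x) = x),
        (opnorm A T < +oo)%E /\ (opnorm (T @` A) Tinv < +oo)%E
      & (opnorm A T * opnorm (T @` A) Tinv <= K%:E)%E].

Definition successive_intervals (I : nat -> set nat) : Prop :=
  exists a b : nat -> nat, forall k : nat,
    [/\ (a k <= b k)%N, (b k < a k.+1)%N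
      & I k = [set n | (a k <= n <= b k)%N]].

Definition tight_with_constants (R : realType) (V : normedModType R)
    (e : nat -> V) : Prop :=
  forall Y : completeNormedModType R,
    inf_dim_subspace [set: Y] ->
    exists I : nat -> set nat,
      successive_intervals I /\
      forall K : nat, ~ embeds K%:R [set: Y] (closed_span (e @` ~` I K)).

Definition crudely_finitely_representable (R : realType)
    (V W : normedModType R) (K : R) (X : set V) (Y : set W) : Prop :=
  forall F : set V, fin_dim_subspace F -> F `<=` X -> embeds K F Y.

Definition locally_minimal (R : realType) (V : normedModType R) (X : set V) :
    Prop :=
  exists K : R, forall Z : set V, inf_dim_subspace Z -> Z `<=` X ->
    crudely_finitely_representable K X Z.

(* Main.v *)
Require Import Defs.
From HB Require Import structures.
From mathcomp Require Import all_boot all_order all_algebra.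
From mathcomp Require Import all_classical all_reals all_analysis.
From mathcomp Require Import ring lra.

Set Implicit Arguments.
Unset Strict Implicit.
Unset Printing Implicit Defensive.

Import Order.TTheory GRing.Theory Num.Theory.
Import numFieldNormedType.Exports.

Local Open Scope classical_set_scope.
Local Open Scope ring_scope.

(** Write [[x_n | n in A]] for a closed linear span. The proof reduces the
    dichotomy to one diagonal construction of a basic sequence.

    Finite-dimensional spaces are separable for the Banach-Mazur distance. Inside
    the closed span of a basic sequence [u], every finite-dimensional subspace is
    2-isomorphic, by perturbing a basis, to the span of a system of finitely many
    finite rational combinations of [u] ([rat_system_dense]). There are countably
    many such systems [q], hence countably many pairs [(q, C)] with [C] an integer
    constant. For one pair and one infinite-dimensional [W], either some subspace
    of [W] does not contain a [C]-copy of [q], or all of them do; so after passing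
    to a subspace the question whether [q] [C]-embeds has the same answer, in the
    strong sense of [decided], at all lower levels. Doing this for all pairs in
    turn gives decreasing subspaces [W n], and Mazur's construction gives a
    basic sequence [x] with [x n] in [W n] ([diagonal_basic]).

    If [x] is tight with constants, there is nothing left to prove. Otherwise some
    [Y] defeats every choice of intervals, and a choice made greedily against [Y]
    yields fixed [K] and [a] such that [Y] embeds with constant [K] in
    [[x_n | n notin [a, b]]] for every [b >= a] ([not_tight_gap]). The bounded
    number [a] of initial vectors can be moved into the gap: for [m >= a] and
    [b = a + m], the map sending [x_i] to [x_(m+i)] for [i < a] and fixing the
    other vectors embeds this space in [[x_n | n >= m]], with a constant
    depending on [a] only ([emb_shift]). So [Y] embeds with one constant in all
    tails of [x].

    Let [Y0] be the copy of [Y] in the span of [x] and [F] a finite-dimensional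
    subspace of [Y0]. Then [F] embeds uniformly in all tails, and so does the
    rational system close to it; by the diagonal construction this system, hence
    [F], embeds uniformly in every infinite-dimensional subspace of [W n], for
    some [n]. A subspace [Z] of [Y0] need not lie in [W n], but its vectors
    whose first [n] coordinates vanish form an infinite-dimensional space that
    does ([inf_dim_tail]). Thus [Y0] is locally minimal, and so is the span
    of any basic sequence of [Y0].

    Mazur's construction needs norming functionals, so the Hahn-Banach theorem is
    proved first, for the norm and by Zorn's lemma on graphs. *)

(** * Subspaces and linear combinations *)

Section LinearSpans.
Variables (R : realType) (V : normedModType R).
Implicit Types (A B S W Z : set V) (v w : nat -> V) (c : nat -> R) (d : nat).

Definition is_subspace A :=
  A 0 /\ forall (a : R) (x y : V), A x -> A y -> A (a *: x + y).

Lemma subspaceE A : submod_closed (mem A) <-> is_subspace A.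
Proof.
split=> -[A0 Alin]; split.
- by move: A0; rewrite /= inE.
- move=> a x y Ax Ay; have := Alin a x y; rewrite !unfold_in /=.
  by rewrite !in_setE => /(_ Ax Ay).
- by rewrite /= inE.
- move=> a x y; rewrite !unfold_in /= !in_setE; exact: Alin.
Qed.

Lemma subspaceZ A a x : is_subspace A -> A x -> A (a *: x).
Proof. by move=> [A0 Alin] Ax; rewrite -[_ *: _]addr0; apply: Alin. Qed.

Lemma subspaceD A x y : is_subspace A -> A x -> A y -> A (x + y).
Proof. by move=> [_ Alin] Ax Ay; rewrite -[x]scale1r; apply: Alin. Qed.

Lemma subspaceB A x y : is_subspace A -> A x -> A y -> A (x - y).
Proof.
by move=> sA Ax Ay; apply: subspaceD => //; rewrite -scaleN1r; apply: subspaceZ.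
Qed.

Lemma subspace_sum A (I : Type) (r : seq I) (P : pred I) (F : I -> V) :
  is_subspace A -> (forall i, P i -> A (F i)) -> A (\sum_(i <- r | P i) F i).
Proof.
move=> sA AF; apply: (big_ind A) => //; first by case: sA.
by move=> x y; apply: subspaceD.
Qed.

(** Finite systems are initial segments of sequences [nat -> V], so that changing
    the number of vectors needs no casts between ordinal types. *)
Definition comb d c v : V := \sum_(i < d) c i *: v i.
Arguments comb d c v : simpl never.

Lemma combS d c v : comb d.+1 c v = comb d c v + c d *: v d.
Proof. by rewrite /comb big_ord_recr. Qed.

Lemma comb0 d v : comb d (fun=> 0) v = 0.
Proof. by rewrite /comb big1 // => i _; rewrite scale0r. Qed.

Lemma combD d c1 c2 v :
  comb d (fun i => c1 i + c2 i) v = comb d c1 v + comb d c2 v.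
Proof. by rewrite /comb -big_split; apply: eq_bigr => i _; rewrite scalerDl. Qed.

Lemma combZ d a c v : comb d (fun i => a * c i) v = a *: comb d c v.
Proof.
by rewrite /comb scaler_sumr; apply: eq_bigr => i _; rewrite scalerA.
Qed.

Lemma combB d c1 c2 v :
  comb d (fun i => c1 i - c2 i) v = comb d c1 v - comb d c2 v.
Proof.
rewrite -scaleN1r -combZ -combD; apply: eq_bigr => i _.
by rewrite mulN1r.
Qed.

Lemma combBr d c v w :
  comb d c (fun i => v i - w i) = comb d c v - comb d c w.
Proof.
by rewrite /comb -sumrB; apply: eq_bigr => i _; rewrite scalerBr.
Qed.

Lemma combZr d a c v : comb d c (fun i => a *: v i) = a *: comb d c v.
Proof.
rewrite /comb scaler_sumr; apply: eq_bigr => i _.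
by rewrite !scalerA mulrC.
Qed.

Lemma eq_comb d c1 c2 v1 v2 : (forall i, (i < d)%N -> c1 i = c2 i) ->
  (forall i, (i < d)%N -> v1 i = v2 i) -> comb d c1 v1 = comb d c2 v2.
Proof. by move=> ec ev; apply: eq_bigr => i _; rewrite ec ?ev. Qed.

Lemma comb_delta d j v : (j < d)%N -> comb d (fun i => (i == j)%:R) v = v j.
Proof.
move=> jd; rewrite /comb (bigD1 (Ordinal jd)) //= eqxx scale1r big1 ?addr0//.
by move=> i; rewrite -val_eqE /= => /negbTE ->; rewrite scale0r.
Qed.

Definition fspan d v : set V := [set x | exists c, x = comb d c v].

Lemma fspan_subspace d v : is_subspace (fspan d v).
Proof.
split; first by exists (fun=> 0); rewrite comb0.
move=> a _ _ [c1 ->] [c2 ->]; exists (fun i => a * c1 i + c2 i).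
by rewrite combD combZ.
Qed.

Lemma fspan_gen d v i : (i < d)%N -> fspan d v (v i).
Proof. by move=> id; exists (fun k => (k == i)%:R); rewrite comb_delta. Qed.

Lemma fspan_sub d v A : is_subspace A -> (forall i, (i < d)%N -> A (v i)) ->
  fspan d v `<=` A.
Proof.
move=> sA Av _ [c ->]; apply: subspace_sum => // i _.
by apply: subspaceZ => //; apply: Av.
Qed.

Lemma linear_span_subspace S : is_subspace (linear_span S).
Proof.
split.
  by exists 0, (fun=> 0), (fun=> 0); split=> [[]//|]; rewrite big_ord0.
move=> a x y [n [c [v [Sv ->]]]] [m [b [w [Sw ->]]]].
exists (n + m)%N,
  (fun i => match fintype.split i with inl j => a * c j | inr j => b j end),
  (fun i => match fintype.split i with inl j => v j | inr j => w j end).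
split=> [i|]; first by case: fintype.split.
rewrite big_split_ord/= scaler_sumr; congr (_ + _); apply: eq_bigr => i _.
  by rewrite (unsplitK (inl i : 'I_n + 'I_m)%type) scalerA.
by rewrite (unsplitK (inr i : 'I_n + 'I_m)%type).
Qed.

Lemma linear_span_gen S x : S x -> linear_span S x.
Proof.
move=> Sx; exists 1%N, (fun=> 1), (fun=> x); split=> //.
by rewrite big_ord1 scale1r.
Qed.

Lemma linear_span_sub S A : is_subspace A -> S `<=` A -> linear_span S `<=` A.
Proof.
move=> sA SA _ [n [c [v [Sv ->]]]]; apply: subspace_sum => // i _.
by apply: subspaceZ => //; apply: SA.
Qed.

Lemma finite_dimE A : finite_dim A <-> exists d v, A = fspan d v.
Proof.
split=> [[s ->]|[d [v ->]]].
  exists (size s), (nth 0 s); apply/seteqP; split.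
    apply: linear_span_sub; first exact: fspan_subspace.
    move=> x /= xs; rewrite -(nth_index 0 xs); apply: fspan_gen.
    by rewrite index_mem.
  apply: fspan_sub; first exact: linear_span_subspace.
  by move=> i si; apply: linear_span_gen; apply: mem_nth.
exists (mkseq v d); apply/seteqP; split.
  apply: fspan_sub; first exact: linear_span_subspace.
  move=> i id; apply: linear_span_gen => /=.
  by apply/mapP; exists i => //; rewrite mem_iota.
apply: linear_span_sub; first exact: fspan_subspace.
by move=> x /= /mapP[i]; rewrite mem_iota => /andP[_ id] ->; apply: fspan_gen.
Qed.

(** Adding to a finite generating system of the kernel one vector outside it
    generates the whole space. *)
Lemma infdim_ker A (f : V -> R) : is_subspace A ->
  (forall a x y, A x -> A y -> f (a *: x + y) = a * f x + f y) ->
  ~ finite_dim A -> ~ finite_dim (A `&` [set x | f x = 0]).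
Proof.
move=> sA lf infA /finite_dimE[d [v kerE]]; apply: infA.
have [kerA|] := pselect (A `<=` [set x | f x = 0]).
  by apply/finite_dimE; exists d, v; rewrite -kerE setIidl.
move=> /existsNP[w /not_implyP[Aw /= fw]].
have fw0 : f w != 0 by apply/eqP.
apply/finite_dimE; exists d.+1, (fun i => if (i < d)%N then v i else w).
apply/seteqP; split.
  move=> x Ax; have : (A `&` [set x | f x = 0]) ((- (f x / f w)) *: w + x).
    split; first by case: sA => _; apply.
    by rewrite /= lf// mulNr divfK// addNr.
  rewrite kerE => -[c xE].
  exists (fun i => if (i < d)%N then c i else f x / f w).
  rewrite combS ltnn; set t := f x / f w.
  have {1}-> : x = comb d c v + t *: w.
    by rewrite -xE scaleNr addrAC addNr add0r.
  by congr (_ + _); apply: eq_comb => i ->.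
apply: fspan_sub => // i _; case: ifPn => // id.
by have [] : (A `&` [set x | f x = 0]) (v i) by rewrite kerE; apply: fspan_gen.
Qed.

End LinearSpans.

(** * Closures and limits *)

Section Closures.
Variables (R : realType) (V : normedModType R).
Implicit Types (A B S W Z : set V) (v w : nat -> V) (c : nat -> R) (d : nat).

Lemma closure_distP A x :
  closure A x <-> forall e : R, 0 < e -> exists2 y, A y & `|x - y| < e.
Proof.
split=> [clAx e e0|Ax B].
  have [|y [Ay]] := clAx (ball x e); first exact: nbhsx_ballx.
  by rewrite -ball_normE /=; exists y.
rewrite -nbhs_ballE => -[e /= e0 xeB]; have [y Ay xy] := Ax _ e0.
by exists y; split=> //; apply: xeB; rewrite -ball_normE.
Qed.

Lemma closed_distP A :
  closed A <-> forall x, (forall e : R, 0 < e -> exists2 y, A y & `|x - y| < e) -> A x.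
Proof.
by split=> cA x; [move=> h; apply: cA; apply/closure_distP|move/closure_distP; apply: cA].
Qed.

Lemma closure_seq A x : closure A x ->
  exists u : nat -> V, (forall n, A (u n)) /\ u @ \oo --> x.
Proof.
move=> /closure_distP Ax.
have /choice[u uP] : forall n : nat, exists y, A y /\ `|x - y| < n.+1%:R^-1.
  by move=> n; have [|y Ay xy] := Ax n.+1%:R^-1; [rewrite invr_gt0|exists y].
exists u; split=> [n|]; first by case: (uP n).
apply/cvgrPdist_lt => e e0; near=> n.
apply: lt_trans (proj2 (uP n)) _.
near: n; exact: near_infty_natSinv_lt (PosNum e0).
Unshelve. all: by end_near. Qed.

Lemma closed_seq A (u : nat -> V) x : closed A -> (forall n, A (u n)) ->
  u @ \oo --> x -> A x.
Proof. by move=> cA Au; apply: closed_cvg => //; near=> n; apply: Au.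
Unshelve. all: by end_near. Qed.

Lemma cvg_norm_le (W : normedModType R) (u : nat -> V) (w : nat -> W)
    (x : V) (y : W) (C : R) :
  u @ \oo --> x -> w @ \oo --> y -> (forall n, `|u n| <= C * `|w n|) ->
  `|x| <= C * `|y|.
Proof.
move=> ux wy uw.
apply: (ler_cvg_to (cvg_norm ux) (cvgM (cvg_cst C) (cvg_norm wy))).
by near=> n; apply: uw.
Unshelve. all: by end_near. Qed.

(** Bounded linear images of a convergent sequence converge, as they are Cauchy;
    only the values on the sequence matter, so the map may be defined on a
    subspace that misses the limit. *)
Lemma cvg_lipschitz (W : completeNormedModType R) (u : nat -> V) (w : nat -> W)
    (x : V) (C : R) :
  u @ \oo --> x -> (forall n m, `|w n - w m| <= C * `|u n - u m|) ->
  exists y : W, w @ \oo --> y.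
Proof.
move=> ux uw.
have wlim : cvg (w @ \oo).
  apply: cauchy_cvg; apply: cauchy_exP => e e0.
  pose D := `|C| + 1.
  have D0 : 0 < D by rewrite ltr_wpDl.
  have /cvgrPdist_lt/(_ (e / (2 * D))) := ux.
  rewrite divr_gt0 ?mulr_gt0// => /(_ isT) [N _ uN].
  exists (w N); exists N => // n /= Nn.
  rewrite -ball_normE /=; apply: le_lt_trans (uw _ _) _.
  have un : `|u N - u n| < e / D.
    have -> : e / D = e / (2 * D) + e / (2 * D) by field; rewrite gt_eqF.
    have -> : u N - u n = (x - u n) - (x - u N).
      by rewrite opprB [RHS]addrC subrKA.
    by apply: le_lt_trans (ler_normB _ _) _; apply: ltrD; apply: uN => /=.
  apply: le_lt_trans (_ : D * `|u N - u n| < e).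
    by rewrite ler_wpM2r// (le_trans (ler_norm _))// lerDl.
  by rewrite mulrC -ltr_pdivlMr.
by move/cvg_ex: wlim.
Qed.

Lemma closure_subspace A : is_subspace A -> is_subspace (closure A).
Proof.
move=> [A0 Al]; split; first exact: subset_closure.
move=> a x y /closure_seq[u [Au ux]] /closure_seq[w [Aw wy]].
apply: (@closed_seq _ (fun n => a *: u n + w n)).
- exact: closed_closure.
- by move=> n; apply: subset_closure; apply: Al.
- by apply: cvgD => //; apply: cvgZl_tmp.
Qed.

Lemma closed_span_subspace S : is_subspace (closed_span S).
Proof. by apply: closure_subspace; exact: linear_span_subspace. Qed.

Lemma closed_span_closed S : closed (closed_span S).
Proof. exact: closed_closure. Qed.

Lemma closed_span_gen S x : S x -> closed_span S x.
Proof. by move=> Sx; apply: subset_closure; apply: linear_span_gen. Qed.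

Lemma closed_span_sub S A : is_subspace A -> closed A -> S `<=` A ->
  closed_span S `<=` A.
Proof.
move=> sA cA SA; rewrite [X in _ `<=` X](closure_id _).1//.
by apply: closure_subset; apply: linear_span_sub.
Qed.

End Closures.

(** * Finite-dimensional subspaces *)

Section FiniteDimension.
Variables (R : realType) (V : normedModType R).
Implicit Types (A B S W Z : set V) (v w : nat -> V) (c : nat -> R) (d : nat).

(** A quantitative form of linear independence. *)
Definition coef_bound d v (C : R) :=
  forall c i, (i < d)%N -> `|c i| <= C * `|comb d c v|.

(** The coefficients of a convergent sequence of combinations converge. *)
Lemma coef_bound_closed d v C : coef_bound d v C -> closed (fspan d v).
Proof.
move=> bC; apply/closed_distP => x /closure_distP /closure_seq[u [su ux]].
have /choice[c cE] := su.
have /choice[l lE] : forall i, exists li : R,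
    (i < d)%N -> (fun n => c n i) @ \oo --> li.
  move=> i; case: (ltnP i d) => [id|_]; last by exists 0.
  have [n m|y] := cvg_lipschitz (w := fun n => c n i : R^o) (C := C) ux.
    by rewrite !cE -combB; apply: (bC (fun k => c n k - c m k)).
  by exists y.
exists l.
apply: (@cvg_unique _ _ (u @ \oo)) => //.
have -> : u = (fun n => \sum_(i < d) c n i *: v i) by apply/funext => n; exact: cE.
apply: cvg_big => [|i _]; first exact: add_continuous.
by apply: cvgZr_tmp; apply: lE.
Qed.

Lemma closed_dist A x : closed A -> ~ A x ->
  exists2 e : R, 0 < e & forall y, A y -> e <= `|x - y|.
Proof.
move=> /closed_distP/(_ x) Ax /(contra_not Ax) /existsNP[e /not_implyP[e0 xe]].
exists e => // y Ay; rewrite leNgt; apply/negP => xy; apply: xe.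
by exists y.
Qed.

(** Generators are added one at a time. A redundant one is dropped; any other one
    is at positive distance from the closed span of the previous ones, and this
    distance bounds its coefficient. *)
Lemma fspan_basis d v :
  exists d' v' C, [/\ fspan d' v' = fspan d v, 0 <= C & coef_bound d' v' C].
Proof.
elim: d => [|d [d' [v' [C [spanE C0 bC]]]]].
  by exists 0%N, v, 0; split.
have [vd|vd] := pselect (fspan d v (v d)).
  exists d', v', C; split=> //; rewrite spanE; apply/seteqP; split.
    apply: fspan_sub; first exact: fspan_subspace.
    by move=> i id; apply: fspan_gen; rewrite ltnS ltnW.
  apply: fspan_sub; first exact: fspan_subspace.
  by move=> i; rewrite ltnS leq_eqVlt => /predU1P[->//|]; apply: fspan_gen.
have [|e e0 de] := closed_dist (coef_bound_closed bC) (x := v d).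
  by rewrite spanE.
pose w i := if (i < d')%N then v' i else v d.
have wE c : comb d'.+1 c w = comb d' c v' + c d' *: v d.
  by rewrite combS {2}/w ltnn; congr (_ + _); apply: eq_comb => // i; rewrite /w => ->.
exists d'.+1, w, ((1 + C * `|v d|) / e + C); split.
- apply/seteqP; split.
    apply: fspan_sub; first exact: fspan_subspace.
    move=> i _; rewrite /w; case: ifPn => id; last exact: fspan_gen.
    have : fspan d v (v' i) by rewrite -spanE; apply: fspan_gen.
    apply: fspan_sub; first exact: fspan_subspace.
    by move=> j jd; apply: fspan_gen; rewrite ltnS ltnW.
  have sub : fspan d v `<=` fspan d'.+1 w.
    rewrite -spanE; apply: fspan_sub; first exact: fspan_subspace.
    move=> j jd; have := @fspan_gen _ _ d'.+1 w j; rewrite /w jd; apply.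
    by rewrite ltnS ltnW.
  apply: fspan_sub; first exact: fspan_subspace.
  move=> i; rewrite ltnS leq_eqVlt => /predU1P[->|id].
    by have := @fspan_gen _ _ d'.+1 w d' (ltnSn _); rewrite /w ltnn.
  by apply: sub; apply: fspan_gen.
- by rewrite addr_ge0// divr_ge0 ?addr_ge0 ?mulr_ge0// ltW.
- move=> c i id; rewrite wE; set x := comb _ _ _ + _.
  have cd : `|c d'| * e <= `|x|.
    have [->|cd0] := eqVneq (c d') 0; first by rewrite normr0 mul0r.
    rewrite mulrC -ler_pdivlMr ?normr_gt0//.
    have -> : `|x| / `|c d'| = `|v d - (- (c d')^-1) *: comb d' c v'|.
      rewrite scaleNr opprK -normfV mulrC -normrZ /x scalerDr scalerA.
      by rewrite mulVf// scale1r addrC.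
    apply: de; apply: subspaceZ; first exact: fspan_subspace.
    by exists c.
  have {}cd : `|c d'| <= `|x| / e by rewrite ler_pdivlMr.
  move: id; rewrite ltnS leq_eqVlt => /predU1P[->|id].
    apply: le_trans cd _; rewrite mulrC ler_wpM2r//.
    rewrite mulrDl mul1r -addrA lerDl addr_ge0// !mulr_ge0// invr_ge0 ltW//.
  apply: le_trans (bC _ _ id) _.
  have -> : comb d' c v' = x - c d' *: v d by rewrite /x addrK.
  apply: le_trans (ler_wpM2l C0 (ler_normB _ _)) _.
  rewrite normrZ.
  apply: le_trans (ler_wpM2l C0 (lerD (lexx _) (ler_wpM2r (normr_ge0 _) cd))) _.
  have : 0 <= `|x| / e by rewrite divr_ge0// ltW.
  rewrite mulrDr mulrDl addrC lerD2r mulrDl.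
  have -> : C * (`|x| / e * `|v d|) = C * `|v d| / e * `|x| by ring.
  by move=> xe; rewrite mulrDl ler_wpDl// mul1r mulrC.
Qed.

Lemma net_itv (C e : R) : 0 < e -> exists Q : seq R,
  forall t, `|t| <= C -> exists2 q, q \in Q & `|t - q| <= e.
Proof.
(* a grid of step [e]; rounding down picks the point *)
move=> e0; exists [seq - C + e * k%:R | k <- iota 0 (Num.truncn (2 * C / e)).+1].
move=> t /ler_normlP[tC1 tC2].
have h0 : 0 <= (t + C) / e by apply: divr_ge0; [lra|exact: ltW].
exists (- C + e * (Num.truncn ((t + C) / e))%:R).
  apply/mapP; exists (Num.truncn ((t + C) / e)) => //.
  rewrite mem_iota /= add0n ltnS le_truncn//.
  by apply: ler_wpM2r; [rewrite invr_ge0 ltW|lra].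
have /andP[] := truncn_itv h0; set k := Num.truncn _.
rewrite ler_pdivlMr// ltr_pdivrMr// => h1; rewrite -natr1 mulrDl mul1r => h2.
by rewrite ler_norml; apply/andP; split; lra.
Qed.

(** Total boundedness, in the form needed to norm a finite-dimensional space by
    finitely many functionals. *)
Lemma net_comb d v (C e : R) : 0 < e -> exists N : seq V,
  forall c, (forall i, (i < d)%N -> `|c i| <= C) ->
    exists2 y, y \in N & `|comb d c v - y| <= e.
Proof.
elim: d e => [|d IH] e e0.
  exists [:: 0] => c _; exists 0; first by rewrite inE.
  by rewrite /comb big_ord0 subrr normr0 ltW.
have e20 : 0 < e / 2 by rewrite divr_gt0.
have [N Nnet] := IH _ e20.
have v0 : 0 < 1 + `|v d| by rewrite ltr_pwDl.
have [Q Qnet] := @net_itv C (e / 2 / (1 + `|v d|)) (divr_gt0 e20 v0).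
exists [seq y + q *: v d | y <- N, q <- Q] => c cC.
have [i id|y yN ye] := Nnet c; first by apply: cC; rewrite ltnS ltnW.
have [q qQ qe] := Qnet _ (cC d (ltnSn _)).
exists (y + q *: v d); first by apply/allpairsP; exists (y, q).
rewrite combS opprD addrACA -scalerBl.
apply: le_trans (ler_normD _ _) _; rewrite normrZ [leRHS]splitr lerD//.
apply: le_trans (ler_wpM2r (normr_ge0 _) qe) _.
rewrite -[leLHS]mulrA ler_piMr ?(ltW e20)// mulrC ler_pdivrMr//.
by rewrite mul1r lerDr.
Qed.

End FiniteDimension.

(** * The Hahn-Banach theorem *)

Section HahnBanach.
Variables (R : realType) (V : normedModType R).

Definition is_functional (f : V -> R) :=
  (forall a x y, f (a *: x + y) = a * f x + f y) /\ (forall x, `|f x| <= `|x|).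

(** Graphs of norm-dominated linear forms on subspaces. Domination makes such a
    relation single-valued: it forces [r <= 0] whenever [(0, r)] is in it. As
    sets of pairs, the forms are ordered by inclusion, as Zorn's lemma needs. *)
Definition dominated_graph (G : set (V * R)) :=
  [/\ G (0, 0),
      (forall a x r y s, G (x, r) -> G (y, s) -> G (a *: x + y, a * r + s))
    & forall x r, G (x, r) -> r <= `|x|].

(** The value [t] at the new vector [v] must satisfy
    [r - |x - v| <= t <= |y + v| - s] for all [(x, r)] and [(y, s)] in the graph;
    the triangle inequality makes the two sides compatible. *)
Lemma dominated_graph_extend G v : dominated_graph G ->
  exists G', [/\ dominated_graph G', G `<=` G' & exists t, G' (v, t)].
Proof.
move=> [G0 Gl Gd].
have GZ a x r : G (x, r) -> G (a *: x, a * r).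
  by move=> Gx; have := Gl a _ _ _ _ Gx G0; rewrite !addr0.
pose L := [set p.2 - `|p.1 - v| | p in G].
have Lub y s : G (y, s) -> ubound L (`|y + v| - s).
  move=> Gy _ [[x r] Gx <-] /=.
  have := Gl 1 _ _ _ _ Gx Gy; rewrite scale1r mul1r => /Gd h.
  have h2 := ler_normD (x - v) (y + v); rewrite addrACA addNr addr0 in h2.
  lra.
have L0 : L !=set0 by exists (0 - `|0 - v|), (0, 0).
have supL : has_sup L by split => //; exists (`|0 + v| - 0); apply: Lub.
pose t := sup L.
have t1 x r : G (x, r) -> r - `|x - v| <= t.
  by move=> Gx; apply: ub_le_sup; [exact: (proj2 supL)|exists (x, r)].
have t2 y s : G (y, s) -> t <= `|y + v| - s.
  by move=> Gy; apply: ge_sup => //; exact: Lub.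
pose G' := [set q | exists x r c, G (x, r) /\ q = (x + c *: v, r + c * t)].
exists G'; split.
- split.
  + by exists 0, 0, 0; split=> //; rewrite scale0r mul0r !addr0.
  + move=> a _ _ _ _ [x [r [c [Gx [-> ->]]]]] [y [s [b [Gy [-> ->]]]]].
    exists (a *: x + y), (a * r + s), (a * c + b); split; first exact: Gl.
    by congr pair; [rewrite scalerDr scalerA scalerDl addrACA|ring].
  + move=> _ _ [x [r [c [Gx [-> ->]]]]].
    have [c0|c0|->] := ltgtP c 0; last by rewrite scale0r mul0r !addr0; exact: Gd.
    * have := t1 _ _ (GZ (- c)^-1 _ _ Gx) => h.
      have nc : 0 < - c by rewrite oppr_gt0.
      have -> : x + c *: v = (- c) *: ((- c)^-1 *: x - v).
        by rewrite scalerBr scalerA divff ?gt_eqF// scale1r scaleNr opprK.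
      rewrite normrZ gtr0_norm//.
      have := ler_wpM2l (ltW nc) h; rewrite mulrBr mulrA divff ?gt_eqF// mul1r.
      lra.
    * have := t2 _ _ (GZ c^-1 _ _ Gx) => h.
      have -> : x + c *: v = c *: (c^-1 *: x + v).
        by rewrite scalerDr scalerA divff ?gt_eqF// scale1r.
      rewrite normrZ gtr0_norm//.
      have := ler_wpM2l (ltW c0) h; rewrite mulrBr mulrA divff ?gt_eqF// mul1r.
      lra.
- by move=> [x r] Gx; exists x, r, 0; split=> //; rewrite scale0r mul0r !addr0.
- by exists t, 0, 0, 1; split=> //; rewrite scale1r mul1r !add0r.
Qed.

Lemma dominated_graph_line y : exists G, dominated_graph G /\ G (y, `|y|).
Proof.
exists [set q | exists a, q = (a *: y, a * `|y|)]; split; last first.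
  by exists 1; rewrite scale1r mul1r.
split.
- by exists 0; rewrite scale0r mul0r.
- move=> a _ _ _ _ [b [-> ->]] [c [-> ->]]; exists (a * b + c).
  by rewrite scalerDl scalerA mulrDl mulrA.
- move=> _ _ [a [-> ->]]; rewrite normrZ ler_wpM2r//; exact: ler_norm.
Qed.

Lemma hahn_banach_norming y : exists f, is_functional f /\ f y = `|y|.
Proof.
have [G0 [dG0 G0y]] := dominated_graph_line y.
(* the empty set is admitted because it is the union of the empty chain *)
pose P G := G = set0 \/ dominated_graph G /\ G0 `<=` G.
have [F FP Ftot|G [PG Gmax]] := Zorn_bigcup (P := P).
  have [Fe|] := pselect (\bigcup_(X in F) X = set0); first by left.
  move=> /eqP/set0P[p [X0 FX0 X0p]]; right.
  have FdG X : F X -> X !=set0 -> dominated_graph X /\ G0 `<=` X.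
    by move=> FX [q Xq]; have [X_0|//] := FP _ FX; rewrite X_0 in Xq.
  have [dX0 G0X0] := FdG _ FX0 (ex_intro _ p X0p).
  split; last by move=> q /G0X0 ?; exists X0.
  split.
  - by exists X0 => //; case: dX0.
  - move=> a x r z s [X FX Xx] [Z FZ Zz].
    have [dX _] := FdG _ FX (ex_intro _ _ Xx).
    have [dZ _] := FdG _ FZ (ex_intro _ _ Zz).
    have [XZ|ZX] := Ftot _ _ FX FZ.
      by exists Z => //; case: dZ => _ Zl _; apply: Zl => //; apply: XZ.
    by exists X => //; case: dX => _ Xl _; apply: Xl => //; apply: ZX.
  - move=> x r [X FX Xx]; have [[_ _ Xd] _] := FdG _ FX (ex_intro _ _ Xx).
    exact: Xd.
have [dG G0G] : dominated_graph G /\ G0 `<=` G.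
  case: PG => // G_0; exfalso; apply: (Gmax G0); last by right; split=> // ?.
  by rewrite G_0; split=> // /(_ _ G0y).
have [GO Gl Gd] := dG.
have /choice[f fP] : forall x, exists r, G (x, r).
  move=> x; have [G' [dG' GG' [t G't]]] := dominated_graph_extend x dG.

  exists t; apply: contrapT => nG; apply: (Gmax G').
    by split=> // /(_ _ G't) Gt; exact: nG.
  by right; split=> //; apply: subset_trans GG'.
have Gle x r s : G (x, r) -> G (x, s) -> r <= s.
  move=> Gr Gs; have := Gl (-1) _ _ _ _ Gs Gr.
  by rewrite scaleN1r addNr mulN1r => /Gd; rewrite normr0 addrC subr_le0.
have Gun x r s : G (x, r) -> G (x, s) -> r = s.
  by move=> Gr Gs; apply/eqP; rewrite eq_le !(Gle x).
exists f; split; last by apply: (Gun y) => //; apply: G0G.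
split=> [a x z|x]; first by apply: Gun (fP _) _; apply: Gl.
rewrite ler_norml (Gd _ _ (fP x)) andbT lerNl -normrN.
apply: (Gd (- x)); have := Gl (-1) _ _ _ _ (fP x) GO.
by rewrite scaleN1r mulN1r !addr0.
Qed.

End HahnBanach.

(** * Mazur's construction of basic sequences *)

Section Mazur.
Variables (R : realType) (V : normedModType R).
Implicit Types (A B S W Z : set V) (v w : nat -> V) (c : nat -> R) (d : nat).

Lemma inf_dimP A : inf_dim_subspace A <->
  [/\ is_subspace A, closed A & ~ finite_dim A].
Proof. by split=> -[/subspaceE]. Qed.

Lemma closed_subspace_ker A (f : V -> R) (C : R) :
  (forall a x y, A x -> A y -> f (a *: x + y) = a * f x + f y) ->
  (forall x, A x -> `|f x| <= C * `|x|) ->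
  is_subspace A -> closed A ->
  is_subspace (A `&` [set x | f x = 0]) /\ closed (A `&` [set x | f x = 0]).
Proof.
move=> fl fC sA cA; split.
- have [A0 Al] := sA; split=> [|a x y [Ax /= fx] [Ay /= fy]].
    split=> //=; apply/normr0_eq0/le_anti/andP; split => //.
    by have := fC _ A0; rewrite normr0 mulr0.
  by split; [exact: Al|rewrite /= fl// fx fy mulr0 addr0].
- apply/closed_distP => x /closure_distP/closure_seq[u [uA ux]].
  have Ax : A x by apply: closed_seq ux => // n; case: (uA n).
  split=> //=; apply/normr0_eq0/le_anti; rewrite normr_ge0 andbT.
  have : `|f x| <= C * `|x - x|.
    apply: (@cvg_norm_le _ R^o _ (fun=> f x) (fun n => x - u n)).
    + exact: cvg_cst.
    + by apply: cvgB => //; apply: cvg_cst.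
    + move=> n; have [Au fu] := uA n.
      have xuA : A (x - u n) by exact: subspaceB.
      rewrite -{1}(subrK (u n) x) -{1}(scale1r (x - u n)) fl// fu mul1r addr0.
      exact: fC.
  by rewrite subrr normr0 mulr0.
Qed.

Lemma inf_dim_ker A (f : V -> R) (C : R) :
  (forall a x y, A x -> A y -> f (a *: x + y) = a * f x + f y) ->
  (forall x, A x -> `|f x| <= C * `|x|) ->
  inf_dim_subspace A -> inf_dim_subspace (A `&` [set x | f x = 0]).
Proof.
move=> fl fC /inf_dimP[sA cA iA]; apply/inf_dimP.
by have [] := closed_subspace_ker fl fC sA cA; split=> //; exact: infdim_ker.
Qed.

Lemma inf_dim_unit A : inf_dim_subspace A -> exists2 x, A x & `|x| = 1.
Proof.
move=> /inf_dimP[sA _ iA]; apply: contrapT => noA; apply: iA.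
apply/finite_dimE; exists 0%N, (fun=> 0); apply/seteqP; split; last first.
  by apply: fspan_sub.
move=> x Ax; have [->|x0] := eqVneq x 0; first by case: (fspan_subspace 0 (fun=> 0 : V)).
exfalso; apply: noA; exists (`|x|^-1 *: x); first exact: subspaceZ.
by rewrite normrZ normfV normr_id mulVf ?normr_eq0.
Qed.

(** Norming functionals at the points of a net of the unit ball norm the whole
    finite-dimensional space up to a constant. *)
Lemma finite_norming d v : exists (N : seq V) (f : V -> V -> R),
  (forall y, is_functional (f y)) /\
  (forall x, fspan d v x -> exists2 y, y \in N & `|x| <= 2 * f y x).
Proof.
have /choice[f fP] := @hahn_banach_norming R V.
have [d' [v' [C [<- C0 bC]]]] := fspan_basis d v.
have e0 : 0 < (4^-1 : R) by rewrite invr_gt0.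
have [N netN] := net_comb d' v' C e0.
exists N, f; split=> [y|x sx]; first by case: (fP y).
have [c cE] : fspan d' v' (`|x|^-1 *: x).
  by apply: subspaceZ => //; exact: fspan_subspace.
have x1 : `| `|x|^-1 *: x| <= 1.
  rewrite normrZ normfV normr_id; case: (eqVneq x 0) => [->|x0].
    by rewrite normr0 mulr0.
  by rewrite mulVf ?normr_eq0.
have [i id|y yN yx] := netN c.
  by apply: le_trans (bC _ _ id) _; rewrite -cE ler_piMr.
exists y => //; have [ff fy] := fP y; have [fl fle] := ff.
have fZ a z : f y (a *: z) = a * f y z.
  have f0 : f y 0 = 0.
    by apply/normr0_eq0/le_anti; rewrite normr_ge0 -[X in _ <= X](normr0 V) fle.
  by rewrite -[a *: z]addr0 fl f0 addr0.
have [x_0|x0] := eqVneq x 0.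
  by rewrite x_0 -(scale0r 0) fZ mul0r mulr0 scale0r normr0.
have x_gt0 : 0 < `|x| by rewrite normr_gt0.
rewrite -cE in yx.
have h1 : f y (y - `|x|^-1 *: x) <= 4^-1.
  apply: le_trans (ler_norm _) _; apply: le_trans (fle _) _.
  by rewrite distrC.
have h2 : f y (y - `|x|^-1 *: x) = `|y| - `|x|^-1 * f y x.
  by rewrite addrC -scaleNr fl mulNr fy addrC.
have z1 : `| `|x|^-1 *: x| = 1 by rewrite normrZ normfV normr_id mulVf ?normr_eq0.
have h3 := ler_normD (`|x|^-1 *: x - y) y; rewrite subrK z1 in h3.
have : 2^-1 <= `|x|^-1 * f y x by lra.
by rewrite ler_pdivlMl// ler_pdivrMr// mulrC.
Qed.

Lemma inf_dim_kers W (N : seq V) (f : V -> V -> R) :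
  (forall y, is_functional (f y)) -> inf_dim_subspace W ->
  exists W', [/\ inf_dim_subspace W', W' `<=` W
    & forall y z, y \in N -> W' z -> f y z = 0].
Proof.
move=> ff; elim: N W => [|y N IH] W iW; first by exists W; split.
have [|W' [iW' sW' W'0]] := IH (W `&` [set z | f y z = 0]).
  have [fl fb] := ff y; apply: (@inf_dim_ker _ _ 1) => // x _.
  by rewrite mul1r.
exists W'; split=> // [z /sW'[]//|t z].
by rewrite inE => /predU1P[-> /sW'[]//|tN]; apply: W'0.
Qed.

(** Adding a vector killed by a functional does not change its value: vectors
    killed by functionals that norm [fspan d v] up to a factor 2 cannot shorten
    the vectors of [fspan d v] by more than this factor. *)
Lemma mazur W d v : inf_dim_subspace W ->
  exists W', [/\ inf_dim_subspace W', W' `<=` W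
    & forall y z, fspan d v y -> W' z -> `|y| <= 2 * `|y + z|].
Proof.
move=> iW; have [N [f [ff Nf]]] := finite_norming d v.
have [W' [iW' sW' W'0]] := inf_dim_kers N ff iW.
exists W'; split=> // y z /Nf[t tN yt] Wz.
apply: le_trans yt _; rewrite ler_pM2l//.
have [fl fle] := ff t.
have -> : f t y = f t (z + y).
  by rewrite -[z]scale1r fl (W'0 _ _ tN Wz) mulr0 add0r.
by rewrite addrC; apply: le_trans (ler_norm _) (fle _).
Qed.

(** Normalized basic sequences with basis constant 2. All initial segments are
    normed by functionals that kill the rest of the sequence, so one factor 2
    suffices and no product of constants close to 1 appears. *)
Definition basic (x : nat -> V) := (forall n, `|x n| = 1) /\
  forall m n c, (m <= n)%N -> `|comb m c x| <= 2 * `|comb n c x|.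

(** Mazur's construction interleaved with a countable list of requirements [P n]:
    the subspace [W n.+1] is small enough both for the [n]-th requirement and for
    its vectors not to shorten the combinations of the first [n + 1] terms. *)
Lemma diagonal_basic (P : nat -> set V -> Prop) W0 : inf_dim_subspace W0 ->
  (forall n W, inf_dim_subspace W ->
    exists W', [/\ inf_dim_subspace W', W' `<=` W & P n W']) ->
  exists (W : nat -> set V) (x : nat -> V),
    [/\ basic x, W 0%N = W0, forall n m, (n <= m)%N -> W n (x m)
      & forall n, inf_dim_subspace (W n) /\ P n (W n.+1)].
Proof.
move=> iW0 PW.
pose upd (L : nat -> V) n y i := if i == n then y else L i.
have /choice[g gP] : forall p : nat * (set V * (nat -> V)),
    exists q : set V * V, inf_dim_subspace p.2.1 ->
      [/\ inf_dim_subspace q.1, q.1 `<=` p.2.1, P p.1 q.1,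
          p.2.1 q.2 /\ `|q.2| = 1
        & forall y z, fspan p.1.+1 (upd p.2.2 p.1 q.2) y -> q.1 z ->
            `|y| <= 2 * `|y + z|].
  move=> [n [W L]] /=; have [iW|niW] := pselect (inf_dim_subspace W); last first.
    by exists (set0, 0).
  have [x Wx x1] := inf_dim_unit iW.
  have [W1 [iW1 sW1 mW1]] := mazur n.+1 (upd L n x) iW.
  have [W2 [iW2 sW2 PW2]] := PW n _ iW1.
  exists (W2, x) => _; split=> //= [z /sW2/sW1//|y z sy /sW2]; exact: mW1.
(* the state at stage [n]: the current subspace and the terms chosen so far *)
pose st := fix st n := if n is m.+1 then
  ((g (m, st m)).1, upd (st m).2 m (g (m, st m)).2) else (W0, fun=> 0).
pose W n := (st n).1; pose x n := (g (n, st n)).2.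
have iW n : inf_dim_subspace (W n).
  by elim: n => // n IH; case: (gP (n, st n) IH).
have stx n i : (i < n)%N -> (st n).2 i = x i.
  elim: n => // n IH; rewrite ltnS leq_eqVlt /= /upd.
  by case: eqVneq => [-> _|_ /= /IH].
have sW n m : (n <= m)%N -> W m `<=` W n.
  elim: m => [|m IH]; first by rewrite leqn0 => /eqP ->.
  rewrite leq_eqVlt => /predU1P[->//|/IH].
  by apply: subset_trans; case: (gP (m, st m) (iW m)).
have Wx n m : (n <= m)%N -> W n (x m).
  by move=> nm; apply: (sW _ _ nm); case: (gP (m, st m) (iW m)) => _ _ _ [].
exists W, x; split=> //; last first.
  by move=> n; split=> //; case: (gP (n, st n) (iW n)).
split=> [n|m n c mn]; first by case: (gP (n, st n) (iW n)) => _ _ _ [].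
case: m mn => [|m] mn; first by rewrite /comb big_ord0 normr0 mulr_ge0.
have [_ _ _ _ /= h] := gP (m, st m) (iW m).
have sWm : is_subspace (W m.+1) by have /inf_dimP[] := iW m.+1.
rewrite -(subrK (comb m.+1 c x) (comb n c x)) [X in _ <= _ * `|X|]addrC.
apply: h.
  exists c; apply: eq_comb => // i; rewrite ltnS leq_eqVlt /upd.
  by case: eqVneq => [->//|_ /= im]; rewrite stx.
elim: n mn => // n IH; rewrite leq_eqVlt => /predU1P[<-|mn].
  by rewrite subrr; case: sWm.
rewrite [comb n.+1 _ _]combS addrAC; apply: subspaceD => //; first exact: IH.
by apply: subspaceZ => //; apply: (Wx m.+1).
Qed.

End Mazur.

(** * Expansions along a basic sequence *)

(** Expressing [d + 1] of the vectors through [d] generators gives a matrix with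
    too many rows for its rank, hence a nontrivial relation between its rows. *)
Lemma independent_inf_dim (R : realType) (V : normedModType R) (A : set V)
    (x : nat -> V) :
  (forall n c, comb n c x = 0 -> forall i, (i < n)%N -> c i = 0) ->
  (forall n, A (x n)) -> ~ finite_dim A.
Proof.
move=> indep Ax /finite_dimE[d [v AE]].
have /choice[m mE] : forall n, exists c, x n = comb d c v.
  by move=> n; have := Ax n; rewrite AE.
pose M : 'M[R]_(d.+1, d) := \matrix_(i, j) m i j.
have : kermx M != 0.
  rewrite kermx_eq0 /row_free; apply/eqP => rM.
  by have := rank_leq_col M; rewrite rM ltnn.
case/rowV0Pn => r /sub_kermxP rM0 /eqP; apply; apply/rowP => k.
rewrite mxE -[k](inord_val k).
apply: (indep d.+1 (fun i => r ord0 (inord i)) _ k (ltn_ord k)).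
transitivity (\sum_(j < d) (r *m M) ord0 j *: v j); last first.
  by rewrite rM0 big1 // => j _; rewrite mxE scale0r.
under [RHS]eq_bigr => j _ do rewrite mxE scaler_suml.
rewrite exchange_big /=; apply: eq_bigr => i _.
rewrite inord_val mE /comb scaler_sumr; apply: eq_bigr => j _.
by rewrite scalerA mxE.
Qed.

Section BasicSequences.
Variables (R : realType) (V : normedModType R) (x : nat -> V).
Hypothesis bx : basic x.
Implicit Types (s t : V) (a b c : nat -> R).

Let x1 n : `|x n| = 1. Proof. exact: (proj1 bx). Qed.

Definition expands s a := (fun n => comb n a x) @ \oo --> s.

Let X := closed_span (range x).

Lemma expands_comb s a n : expands s a -> `|comb n a x| <= 2 * `|s|.
Proof.
move=> sa.
have h : 2 * `|comb k a x| @[k --> \oo] --> 2 * `|s|.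
  by apply: cvgM; [exact: cvg_cst|exact: cvg_norm].
have h' : `|comb n a x| @[_ --> \oo] --> `|comb n a x| by exact: cvg_cst.
apply: (ler_cvg_to h' h).
by near=> k; apply: (proj2 bx); near: k; exact: nbhs_infty_ge.
Unshelve. all: by end_near. Qed.

Lemma expands_coef s a n : expands s a -> `|a n| <= 4 * `|s|.
Proof.
move=> sa; have -> : `|a n| = `|comb n.+1 a x - comb n a x|.
  by rewrite combS addrC addKr normrZ x1 mulr1.
apply: le_trans (ler_normB _ _) _.
have := expands_comb n sa; have := expands_comb n.+1 sa; lra.
Qed.

Lemma expands_lin r s t a b : expands s a -> expands t b ->
  expands (r *: s + t) (fun i => r * a i + b i).
Proof.
move=> sa tb; rewrite /expands.
have -> : (fun n => comb n (fun i => r * a i + b i) x) =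
          (fun n => r *: comb n a x + comb n b x).
  by apply/funext => n; rewrite combD combZ.
by apply: cvgD => //; apply: cvgZl_tmp.
Qed.

Arguments expands_lin r {s t a b} _ _.

Lemma expands_sub s t a b : expands s a -> expands t b ->
  expands (s - t) (fun i => a i - b i).
Proof.
move=> sa tb; rewrite /expands.
have -> : (fun n => comb n (fun i => a i - b i) x) =
          (fun n => comb n a x - comb n b x).
  by apply/funext => n; rewrite combB.
exact: cvgB.
Qed.

Lemma expands_unique s a b : expands s a -> expands s b -> a = b.
Proof.
move=> sa sb; apply/funext => n; apply/eqP; rewrite -subr_eq0 -normr_le0.
by have := expands_coef n (expands_sub sa sb); rewrite subrr normr0 mulr0.
Qed.

Lemma expands_gen k : expands (x k) (fun i => (i == k)%:R).
Proof.
apply/cvgrPdist_lt => e e0; near=> n.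
rewrite comb_delta ?subrr ?normr0//; near: n; exact: nbhs_infty_gt.
Unshelve. all: by end_near. Qed.

(** The coefficients of approximating vectors form Cauchy sequences, and the
    initial segments of their expansions converge uniformly in the length of the
    segment; so the limit expansion represents the limit vector. *)
Lemma expands_closed : closed [set s | exists a, expands s a].
Proof.
apply/closed_distP => s /closure_distP/closure_seq[u [/choice[a ua] us]].
have ucomb k l n : `|comb n (a k) x - comb n (a l) x| <= 2 * `|u k - u l|.
  by rewrite -combB; apply: expands_comb; apply: expands_sub.
have /choice[b ab] : forall n, exists bn : R, (fun k => a k n) @ \oo --> bn.
  move=> n; apply: (cvg_lipschitz (W := R^o) (C := 4) us) => k l.
  exact: expands_coef (expands_sub (ua k) (ua l)).
exists b.
have bcomb n k : `|comb n b x - comb n (a k) x| <= 2 * `|s - u k|.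
  apply: (@cvg_norm_le _ _ _ (fun l => comb n (a l) x - comb n (a k) x)
     (fun l => u l - u k)).
  - apply: cvgB; last exact: cvg_cst.
    apply: cvg_big => [|i _]; first exact: add_continuous.
    by apply: cvgZr_tmp; apply: ab.
  - by apply: cvgB => //; exact: cvg_cst.
  - by move=> l; apply: ucomb.
apply/cvgrPdist_lt => e e0.
have e4 : 0 < e / 4 by rewrite divr_gt0.
have /cvgrPdist_lt/(_ _ e4)[k _ /(_ k (leqnn k)) /= sk] := us.
have /cvgrPdist_lt/(_ _ e4) uk := ua k.
near=> n.
have h1 := bcomb n k.
have h2 : `|u k - comb n (a k) x| < e / 4 by near: n.
have -> : s - comb n b x = (s - u k) + (u k - comb n (a k) x) -
    (comb n b x - comb n (a k) x).
  by rewrite addrA subrK opprB addrA subrK.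
apply: le_lt_trans (ler_normB _ _) _.
have := ler_normD (s - u k) (u k - comb n (a k) x); lra.
Unshelve. all: by end_near. Qed.

Lemma expands_subspace : is_subspace [set s | exists a, expands s a].
Proof.
split.
  exists (fun=> 0); rewrite /expands; under eq_fun do rewrite comb0.
  exact: cvg_cst.
by move=> r s t [a sa] [b tb]; exists (fun i => r * a i + b i); apply: expands_lin.
Qed.

Lemma span_expands s : X s <-> exists a, expands s a.
Proof.
split.
  suff : X `<=` [set s | exists a, expands s a] by apply.
  apply: closed_span_sub; [exact: expands_subspace|exact: expands_closed|].
  by move=> _ [k _ <-]; exists (fun i => (i == k)%:R); apply: expands_gen.
move=> [a sa]; apply: (@closed_seq _ _ X _ _ _ _ sa).
  exact: closed_span_closed.
move=> n; apply: subspace_sum; first exact: closed_span_subspace.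
move=> i _; apply: (subspaceZ _ (closed_span_subspace _)).
by apply: closed_span_gen; exists i.
Qed.

Definition coef s : nat -> R := xget (fun=> 0) [set a | expands s a].

Lemma coefP s : X s -> expands s (coef s).
Proof. by move=> /span_expands[a sa]; apply: (xgetPex (fun=> 0)); exists a. Qed.

Lemma coef_eq s a : expands s a -> coef s = a.
Proof.
move=> sa; apply: (expands_unique (coefP _) sa).
by apply/span_expands; exists a.
Qed.

Lemma coef_lin i r s t : X s -> X t ->
  coef (r *: s + t) i = r * coef s i + coef t i.
Proof. by move=> /coefP Xs /coefP Xt; rewrite (coef_eq (expands_lin r Xs Xt)). Qed.

Lemma coef_le i s : X s -> `|coef s i| <= 4 * `|s|.
Proof. by move=> /coefP; exact: expands_coef. Qed.

Lemma coef_gen i k : coef (x k) i = (i == k)%:R.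
Proof. by rewrite (coef_eq (@expands_gen k)). Qed.

Lemma basic_inf_dim : inf_dim_subspace X.
Proof.
apply/inf_dimP; split.
- exact: closed_span_subspace.
- exact: closed_span_closed.
- apply: (@independent_inf_dim _ _ _ x) => [n c c0 i id|n]; last first.
    by apply: closed_span_gen; exists n.
  have ci : `|c i| = `|comb i.+1 c x - comb i c x|.
    by rewrite combS addrC addKr normrZ x1 mulr1.
  have := proj2 bx _ _ c id; have := proj2 bx _ _ c (ltnW id).
  rewrite c0 normr0 mulr0 !normr_le0 => /eqP c1 /eqP c2.
  by apply/normr0_eq0; rewrite ci c1 c2 subrr normr0.
Qed.

Lemma basic_schauder : schauder_basis X x.
Proof.
have expE s a : (series (fun n => a n *: x n) @ \oo --> s) = expands s a.
  rewrite /expands; have -> // : series (fun n => a n *: x n) = fun n => comb n a x.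
  by apply/funext => n; rewrite /series /= big_mkord.
split=> [n|s Xs]; first by apply: closed_span_gen; exists n.
exists (coef s); split=> [|a]; rewrite expE; first exact: coefP.
exact: coef_eq.
Qed.

(** The [i]-th coefficient is continuous and vanishes on the generators. *)
Lemma coef_notin (J : set nat) i s : closed_span (x @` J) s -> ~ J i ->
  coef s i = 0.
Proof.
move=> sJ Ji.
have [sA cA] : is_subspace (X `&` [set s | coef s i = 0]) /\
    closed (X `&` [set s | coef s i = 0]).
  apply: (@closed_subspace_ker _ _ _ _ 4) => [r y z||| ]; first exact: coef_lin.
  - exact: coef_le.
  - exact: closed_span_subspace.
  - exact: closed_span_closed.
suff : closed_span (x @` J) `<=` X `&` [set s | coef s i = 0] by move=> /(_ _ sJ)[].
apply: closed_span_sub => // _ [k Jk <-]; split=> /=.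
  by apply: closed_span_gen; exists k.
by rewrite coef_gen; case: eqP Ji => // ->.
Qed.

Lemma closed_span_image_sub (J : set nat) : closed_span (x @` J) `<=` X.
Proof.
apply: closed_span_sub; [exact: closed_span_subspace|exact: closed_span_closed|].
by move=> _ [k _ <-]; apply: closed_span_gen; exists k.
Qed.

Definition tail m := closed_span (x @` [set k | (m <= k)%N]).

Lemma tailP m s : X s -> (forall i, (i < m)%N -> coef s i = 0) -> tail m s.
Proof.
move=> Xs s0; apply: (@closed_seq _ _ (tail m) _ _ _ _ (coefP Xs)).
  exact: closed_span_closed.
move=> n; apply: subspace_sum; first exact: closed_span_subspace.
move=> i _; case: (ltnP i m) => im.
  by rewrite s0// scale0r; case: (closed_span_subspace (x @` [set k | (m <= k)%N])).
apply: (subspaceZ _ (closed_span_subspace _)).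
by apply: closed_span_gen; exists i.
Qed.

Lemma tail_sub m n : (m <= n)%N -> tail n `<=` tail m.
Proof.
move=> mn; apply: closed_span_sub.
- exact: closed_span_subspace.
- exact: closed_span_closed.
- move=> _ [k /= nk <-]; apply: closed_span_gen; exists k => //=.
  exact: leq_trans nk.
Qed.

(** Vanishing of the first [m] coefficients is a finite number of linear
    conditions, and forces a vector of the span into the [m]-th tail. *)
Lemma inf_dim_tail Z m : inf_dim_subspace Z -> Z `<=` X ->
  exists Z', [/\ inf_dim_subspace Z', Z' `<=` Z & Z' `<=` tail m].
Proof.
move=> iZ ZX.
suff [Z' [iZ' sZ' Z'0]] : exists Z', [/\ inf_dim_subspace Z', Z' `<=` Z &
    forall i s, (i < m)%N -> Z' s -> coef s i = 0].
  exists Z'; split=> // s Zs; apply: tailP => [|i im]; last exact: Z'0.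
  by apply: ZX; apply: sZ'.
elim: m => [|m [Z' [iZ' sZ' Z'0]]]; first by exists Z; split.
exists (Z' `&` [set s | coef s m = 0]); split.
- apply: (@inf_dim_ker _ _ _ _ 4) => // [r s t Zs Zt|s Zs].
    by apply: coef_lin; apply/ZX/sZ'.
  by apply: coef_le; apply/ZX/sZ'.
- by move=> s [/sZ'].
- move=> i s; rewrite ltnS leq_eqVlt => /predU1P[-> []//|im [Zs _]].
  exact: Z'0.
Qed.

End BasicSequences.

(** * Embeddings with constants *)

Section Embeddings.
Variables (R : realType) (V W : normedModType R).
Implicit Types (A : set V) (B : set W) (K : R).

(** Embeddings rescaled so as not to decrease norms: one constant instead of the
    norms of a map and of its inverse. *)
Definition emb K A B := exists T : V -> W,
  [/\ linear_on A T, forall x, A x -> B (T x)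
    & forall x, A x -> `|x| <= `|T x| /\ `|T x| <= K * `|x|].

(** Embeddings of [fspan d v], given by the images of the [v i]. No map has to be
    constructed, and the [v i] may be dependent: the inequalities make the map
    well defined. *)
Definition emb_seq K d (v : nat -> V) B := exists b : nat -> W,
  (forall i, (i < d)%N -> B (b i)) /\
  forall c, `|comb d c v| <= `|comb d c b| /\ `|comb d c b| <= K * `|comb d c v|.

Lemma linear_on0 A (T : V -> W) : linear_on A T -> A 0 -> T 0 = 0.
Proof.
move=> Tl A0; have := Tl 1 0 0 A0 A0; rewrite !scale1r addr0 => /eqP.
by rewrite -subr_eq subrr eq_sym => /eqP.
Qed.

Lemma linear_onZ A (T : V -> W) a x : linear_on A T -> is_subspace A -> A x ->
  T (a *: x) = a *: T x.
Proof.
move=> Tl [A0 _] Ax.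
by rewrite -[a *: x]addr0 Tl// (linear_on0 Tl A0) addr0.
Qed.

Lemma linear_onB A (T : V -> W) x y : linear_on A T -> A x -> A y ->
  T (x - y) = T x - T y.
Proof. by move=> Tl Ax Ay; rewrite addrC -scaleN1r Tl// scaleN1r addrC. Qed.

Lemma linear_on_comb A (T : V -> W) d c v : linear_on A T -> is_subspace A ->
  (forall i, (i < d)%N -> A (v i)) -> T (comb d c v) = comb d c (T \o v).
Proof.
move=> Tl sA; elim: d => [|d IH] Av.
  by rewrite /comb !big_ord0 (linear_on0 Tl)//; case: sA.
rewrite !combS addrC Tl//; last first.
- by apply: subspace_sum => // i _; apply: subspaceZ => //; apply: Av; rewrite ltnS ltnW.
- exact: Av.
- by rewrite addrC IH// => i id; apply: Av; rewrite ltnS ltnW.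
Qed.

End Embeddings.

Section OperatorNorm.
Variables (R : realType).

Lemma opnormP (V W : normedModType R) (A : set V) (T : V -> W) :
  A 0 -> T 0 = 0 -> (forall a x, A x -> A (a *: x) /\ T (a *: x) = a *: T x) ->
  (opnorm A T < +oo)%E ->
  exists a : R, [/\ 0 <= a, opnorm A T = a%:E & forall x, A x -> `|T x| <= a * `|x|].
Proof.
move=> A0 T0 TZ Tfin.
have Tub x : A x -> `|x| <= 1 -> (`|T x|%:E <= opnorm A T)%E.
  by move=> Ax x1; apply: ereal_sup_ubound; exists x.
have T_ge0 : (0 <= opnorm A T)%E.
  by have := Tub 0 A0; rewrite T0 !normr0; apply.
have Tnum : opnorm A T \is a fin_num by rewrite ge0_fin_numE.
exists (fine (opnorm A T)); split; [exact: fine_ge0|by rewrite fineK|].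
move=> x Ax; have [->|x0] := eqVneq x 0; first by rewrite T0 !normr0 mulr0.
have [Ax' Tx'] := TZ `|x|^-1 x Ax.
have := Tub _ Ax'; rewrite Tx' !normrZ !normfV !normr_id mulVf ?normr_eq0//.
move=> /(_ (lexx _)); rewrite -{1}(fineK Tnum) lee_fin.
by rewrite ler_pdivrMl ?normr_gt0// mulrC.
Qed.

Lemma opnorm_ub (V W : normedModType R) (A : set V) (T : V -> W) (a : R) :
  A 0 -> T 0 = 0 -> 0 <= a -> (forall x, A x -> `|T x| <= a * `|x|) ->
  (0 <= opnorm A T <= a%:E)%E.
Proof.
move=> A0 T0 a0 Ta; apply/andP; split.
  apply: ereal_sup_ubound; exists 0; last by rewrite T0 normr0.
  by split=> //; rewrite normr0.
apply: ge_ereal_sup => _ [x [Ax x1] <-]; rewrite lee_fin.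
by apply: le_trans (Ta _ Ax) _; rewrite ler_piMr.
Qed.

Variables (V W : normedModType R).
Implicit Types (A : set V) (B : set W) (K : R).

(** Multiplying the embedding by the norm of its inverse. *)
Lemma embeds_emb K A B : is_subspace A -> is_subspace B ->
  embeds K A B -> emb K A B.
Proof.
move=> sA sB [T [Ti [Tl TB TiK [Tfin Tifin] TK]]].
have A0 : A 0 by case: sA.
have T0 : T 0 = 0 := linear_on0 Tl A0.
have [a x Ax|a [a0 Ta aT]] := opnormP A0 T0 _ Tfin.
  by split; [exact: subspaceZ|apply: (linear_onZ _ Tl)].
have TA0 : (T @` A) 0 by exists 0.
have Ti0 : Ti 0 = 0 by rewrite -{1}T0 TiK.
have [r _ [x Ax <-]|b [b0 Tib bTi]] := opnormP TA0 Ti0 _ Tifin.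
  rewrite -(linear_onZ _ Tl)// !TiK//; last exact: subspaceZ.
  by split=> //; exists (r *: x) => //; apply: subspaceZ.
move: TK; rewrite Ta Tib -EFinM lee_fin => abK.
exists (fun x => b *: T x); split.
- by move=> r x y Ax Ay; rewrite Tl// scalerDr !scalerA mulrC.
- by move=> x Ax; apply: subspaceZ => //; apply: TB; exists x.
- move=> x Ax; rewrite normrZ ger0_norm//; split.
    by rewrite -{1}(TiK _ Ax); apply: bTi; exists x.
  apply: le_trans (ler_wpM2l b0 (aT _ Ax)) _.
  by rewrite mulrA [b * a]mulrC ler_wpM2r.
Qed.

Lemma emb_embeds K A B : 0 <= K -> is_subspace A -> emb K A B -> embeds K A B.
Proof.
move=> K0 sA [T [Tl TB TK]].
have A0 : A 0 by case: sA.
have T0 : T 0 = 0 := linear_on0 Tl A0.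
pose Ti y := xget 0 [set x | A x /\ T x = y].
have TiK x : A x -> Ti (T x) = x.
  move=> Ax; rewrite /Ti; have [Ay Ty] := @xgetPex _ 0 [set z | A z /\ T z = T x]
    (ex_intro _ x (conj Ax erefl)).
  set y := xget _ _ in Ay Ty *; apply/eqP; rewrite -subr_eq0 -normr_le0.
  have [+ _] := TK _ (subspaceB sA Ay Ax).
  by rewrite (linear_onB Tl)// Ty subrr normr0.
have TA0 : (T @` A) 0 by exists 0.
have Ti0 : Ti 0 = 0 by rewrite -{1}T0 TiK.
have /andP[oT0 oTK] := opnorm_ub A0 T0 K0 (fun x Ax => proj2 (TK x Ax)).
have /andP[oTi0 oTi1] : (0 <= opnorm (T @` A) Ti <= 1%:E)%E.
  apply: opnorm_ub => // _ [x Ax <-]; rewrite TiK// mul1r.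
  exact: (proj1 (TK x Ax)).
exists T, Ti; split=> //.
- by move=> _ [x Ax <-]; apply: TB.
- by split; [apply: le_lt_trans oTK _|apply: le_lt_trans oTi1 _]; rewrite ltry.
- by rewrite -[K%:E]mule1; apply: lee_pmul.
Qed.

Lemma emb_seq_emb K d (v : nat -> V) B : is_subspace B ->
  emb_seq K d v B -> emb K (fspan d v) B.
Proof.
move=> sB [b [Bb bK]].
have /choice[c cE] : forall x, exists c, fspan d v x -> x = comb d c v.
  move=> x; have [[c ->]|nx] := pselect (fspan d v x); first by exists c.
  by exists (fun=> 0).
have inj e : comb d e v = 0 -> comb d e b = 0.
  move=> e0; apply/normr0_eq0/le_anti; rewrite normr_ge0 andbT.
  by have [_] := bK e; rewrite e0 normr0 mulr0.
exists (fun x => comb d (c x) b); split.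
- move=> r x y sx sy; rewrite -combZ -combD; apply/eqP.
  rewrite -subr_eq0 -combB; apply/eqP/inj.
  rewrite combB combD combZ -!cE ?subrr//.
  by have [_] := fspan_subspace d v; apply.
- by move=> x _; apply: subspace_sum => // i _; apply: subspaceZ => //; apply: Bb.
- by move=> x sx; rewrite {1 4}(cE _ sx); apply: bK.
Qed.

Lemma emb_seq_le K K' d (v : nat -> V) B : K <= K' -> emb_seq K d v B -> emb_seq K' d v B.
Proof.
move=> KK' [b [Bb bK]]; exists b; split=> // c; have [h1 h2] := bK c.
by split=> //; apply: le_trans h2 _; apply: ler_wpM2r.
Qed.

Lemma emb_seq_sub K d (v : nat -> V) B B' : B `<=` B' ->
  emb_seq K d v B -> emb_seq K d v B'.
Proof. by move=> BB' [b [Bb bK]]; exists b; split=> // i id; apply/BB'/Bb. Qed.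

(** Isomorphism of the spans by [v i |-> w i], with norm and inverse norm at most 2. *)
Definition equivalent_systems d (v w : nat -> V) := forall c,
  `|comb d c w| <= 2 * `|comb d c v| /\ `|comb d c v| <= 2 * `|comb d c w|.

Lemma equivalent_systems_sym d v w : equivalent_systems d v w -> equivalent_systems d w v.
Proof. by move=> vw c; have [] := vw c. Qed.

Lemma emb_seq_equivalent K d (v w : nat -> V) B : 0 <= K -> is_subspace B ->
  equivalent_systems d v w -> emb_seq K d v B -> emb_seq (4 * K) d w B.
Proof.
move=> K0 sB vw [b [Bb bK]]; exists (fun i => 2 *: b i); split.
  by move=> i id; apply: subspaceZ => //; apply: Bb.
move=> c; rewrite combZr normrZ ger0_norm//.
have [h1 h2] := vw c; have [h3 h4] := bK c; split; first lra.
apply: le_trans (_ : 2 * (K * (2 * `|comb d c w|)) <= _); last by lra.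
by rewrite ler_pM2l//; apply: le_trans h4 _; apply: ler_wpM2l.
Qed.

End OperatorNorm.

(** * Rational approximation of finite-dimensional subspaces *)

Section Perturbation.
Variables (R : realType) (V : normedModType R).

Lemma norm_comb_le d c (v : nat -> V) (M N : R) :
  (forall i, (i < d)%N -> `|c i| <= M) -> (forall i, (i < d)%N -> `|v i| <= N) ->
  `|comb d c v| <= d%:R * (M * N).
Proof.
elim: d => [|d IH] cM vN; first by rewrite /comb big_ord0 normr0 mul0r.
rewrite combS -natr1 mulrDl mul1r; apply: le_trans (ler_normD _ _) _.
apply: lerD; last by rewrite normrZ ler_pM// ?cM ?vN.
by apply: IH => i id; [apply: cM|apply: vN]; rewrite ltnS ltnW.
Qed.

Lemma equivalent_systems_perturb d (v w : nat -> V) (C e : R) : coef_bound d v C ->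
  (forall i, (i < d)%N -> `|v i - w i| <= e) -> d%:R * (C * e) <= 2^-1 ->
  equivalent_systems d v w.
Proof.
move=> bC vw small c.
have h : `|comb d c v - comb d c w| <= 2^-1 * `|comb d c v|.
  rewrite -combBr; apply: le_trans (norm_comb_le (fun i => bC c i) vw) _.
  have -> : d%:R * (C * `|comb d c v| * e) = d%:R * (C * e) * `|comb d c v| by ring.
  exact: ler_wpM2r.
have := ler_normB (comb d c v) (comb d c v - comb d c w).
have := ler_normD (comb d c v - comb d c w) (comb d c w).
by rewrite opprB addrCA subrr addr0 subrK; split; lra.
Qed.

Definition rat_vector (u : nat -> V) (r : seq rat) :=
  comb (size r) (fun i => ratr r`_i) u.

Lemma rat_vector_dense u s (e : R) : basic u -> closed_span (range u) s ->
  0 < e -> exists r, `|s - rat_vector u r| <= e.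
Proof.
move=> bu us e0; have e20 : 0 < e / 2 by rewrite divr_gt0.
have /cvgrPdist_lt/(_ _ e20)[n _ /(_ n (leqnn n)) /= sn] := coefP bu us.
have d0 : 0 < e / 2 / n.+1%:R by rewrite divr_gt0.
have /choice[q qP] : forall i, exists q : rat,
    `|coef u s i - ratr q| <= e / 2 / n.+1%:R.
  move=> i; have [|q /andP[]] :=
      @rat_in_itvoo R (coef u s i) (coef u s i + e / 2 / n.+1%:R).
    by rewrite ltrDl.
  rewrite !bnd_simp => q1 q2; exists q.
  by rewrite distrC ger0_norm ?subr_ge0 ?(ltW q1)// lerBlDl ltW.
exists (mkseq q n).
have -> : rat_vector u (mkseq q n) = comb n (fun i => ratr (q i)) u.
  rewrite /rat_vector size_mkseq; apply: eq_comb => // i id.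
  by rewrite nth_mkseq.
rewrite -(subrKA (comb n (coef u s) u)).
apply: le_trans (ler_normD _ _) _; rewrite [e]splitr lerD ?(ltW sn)//.
rewrite -combB.
have := @norm_comb_le n (fun i => coef u s i - ratr (q i)) u (e / 2 / n.+1%:R) 1.
move=> /(_ (fun i _ => qP i)) h; apply: le_trans (h _) _.
  by move=> i _; rewrite (proj1 bu).
rewrite mulr1 mulrCA ler_piMr ?(ltW e20)// ler_pdivrMr// mul1r ler_nat.
exact: leqnSn.
Qed.

End Perturbation.

(** * Failure of tightness with constants *)

Lemma emb_trans (R : realType) (U V W : normedModType R) (K L : R)
    (A : set U) (B : set V) (D : set W) :
  0 <= L -> emb K A B -> emb L B D -> emb (L * K) A D.
Proof.
move=> L0 [T [Tl TB TK]] [S [Sl SD SL]]; exists (S \o T); split.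
- by move=> r x y Ax Ay /=; rewrite Tl// Sl//; apply: TB.
- by move=> x Ax /=; apply/SD/TB.
- move=> x Ax /=; have [t1 t2] := TK _ Ax; have [s1 s2] := SL _ (TB _ Ax).
  split; first exact: le_trans s1.
  by apply: le_trans s2 _; rewrite -mulrA ler_wpM2l.
Qed.

Section Tightness.
Variables (R : realType) (V : normedModType R).

(** If every [K] and [a] had some [b] without embedding, choosing [a k] after the
    [k]-th interval and [b] for the constant [k] would give intervals witnessing
    tightness. *)
Lemma not_tight_gap (e : nat -> V) : ~ tight_with_constants e ->
  exists (Y : completeNormedModType R) (K a : nat), inf_dim_subspace [set: Y] /\
    forall b, (a <= b)%N ->
      embeds K%:R [set: Y] (closed_span (e @` ~` [set n | (a <= n <= b)%N])).
Proof.
move=> /existsNP[Y /not_implyP[iY noI]]; exists Y.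
apply: contrapT => /forallNP noK; apply: noI.
have /choice[f fP] : forall p : nat * nat, exists b, (p.2 <= b)%N /\
    ~ embeds p.1%:R [set: Y] (closed_span (e @` ~` [set n | (p.2 <= n <= b)%N])).
  move=> [K a] /=; have /forallNP/(_ a) := noK K.
  move=> /not_andP[//|/existsNP[b /not_implyP[ab nb]]].
  by exists b.
pose a := fix a k := if k is k'.+1 then (f (k', a k')).+1 else 0%N.
exists (fun k => [set n | (a k <= n <= f (k, a k))%N]); split.
  exists a, (fun k => f (k, a k)) => k; split=> //.
  by have [] := fP (k, a k).
by move=> k; have [] := fP (k, a k).
Qed.

Variable x : nat -> V.
Hypothesis bx : basic x.

Local Notation X := (closed_span (range x)).
Let sX : is_subspace X := closed_span_subspace _.

Let Xx n : X (x n). Proof. by apply: closed_span_gen; exists n. Qed.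

Lemma comb_delta_fun a c j : comb a c (fun i => (j == i)%:R : R^o) =
  if (j < a)%N then c j else 0.
Proof.
case: ifPn => ja; last first.
  rewrite /comb big1 // => i _; case: eqP => [ji|_]; last by rewrite scaler0.
  by move: ja; rewrite ji ltn_ord.
rewrite /comb (bigD1 (Ordinal ja)) //= eqxx big1 ?addr0.
  by rewrite /GRing.scale /= mulr1.
by move=> i; rewrite -val_eqE /= eq_sym => /negbTE ->; rewrite scaler0.
Qed.

(** The embedding moves the initial vectors [x 0, ..., x (a - 1)] to
    [x m, ..., x (m + a - 1)], which lie in the omitted interval. It is a
    perturbation of the identity by [a] rank-one maps, each of norm at most 8, and
    the coefficients needed to undo it are those of the image along the moved
    vectors; hence the constant [1 + 8 a] for the map and for its inverse. *)
Lemma emb_shift a m : (a <= m)%N ->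
  emb ((1 + 8 * a%:R) * (1 + 8 * a%:R))
    (closed_span (x @` ~` [set n | (a <= n <= a + m)%N])) (tail x m).
Proof.
move=> am; set A := closed_span _.
have AX : A `<=` X by exact: closed_span_image_sub.
pose y i := x (m + i)%N - x i.
pose P s := s + comb a (coef x s) y.
have Xy i : X (y i) by exact: (subspaceB sX).
have Xcomb c : X (comb a c y).
  by apply: (subspace_sum _ sX) => i _; apply: (subspaceZ _ sX).
have XP s : A s -> X (P s) by move=> /AX Xs; apply: (subspaceD sX).
have A0 s i : A s -> (a <= i <= a + m)%N -> coef x s i = 0.
  by move=> As aim; apply: (coef_notin bx As); apply.
have coefy j i : coef x (y i) j = (j == m + i)%:R - (j == i)%:R.
  by rewrite /y addrC -scaleN1r coef_lin// mulN1r !coef_gen// addrC.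
have coef_comb c j : coef x (comb a c y) j =
    comb a c (fun i => (j == m + i)%:R : R^o) - (if (j < a)%N then c j else 0).
  have cl : linear_on X (fun s => coef x s j : R^o).
    by move=> r s t Xs Xt; rewrite coef_lin.
  rewrite (linear_on_comb (T := fun s => coef x s j : R^o) _ cl)//.
  by rewrite -comb_delta_fun -combBr; apply: eq_comb => // i _; rewrite /= coefy.
have coefP_lt s j : A s -> (j < m)%N -> coef x (P s) j = 0.
  move=> As jm; have Xs := AX _ As.
  rewrite /P -[s in s + _]scale1r coef_lin// mul1r coef_comb.
  have -> : comb a (coef x s) (fun i => (j == m + i)%:R : R^o) = 0.
    rewrite /comb big1 // => i _; case: eqP => [ji|_]; last by rewrite scaler0.
    by move: jm; rewrite ji ltnNge leq_addr.
  case: ifPn => ja; first by rewrite sub0r subrr.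
  by rewrite subrr addr0 A0// leqNgt ja /= (leq_trans (ltnW jm))// leq_addl.
have coefP_m s k : A s -> (k < a)%N -> coef x (P s) (m + k) = coef x s k.
  move=> As ka; have Xs := AX _ As.
  rewrite /P -[s in s + _]scale1r coef_lin// mul1r coef_comb A0//; last first.
    by rewrite (leq_trans am) ?leq_addr//= addnC leq_add2r ltnW.
  rewrite add0r [(m + k < a)%N]ltnNge (leq_trans am) ?leq_addr//= subr0.
  under [X in comb _ _ X]eq_fun do rewrite eqn_add2l.
  by rewrite comb_delta_fun ka.
have y2 i : (i < a)%N -> `|y i| <= 2.
  by move=> _; apply: le_trans (ler_normB _ _) _; rewrite !(proj1 bx).
pose D : R := 1 + 8 * a%:R.
have D1 : 1 <= D by rewrite lerDl mulr_ge0.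
have PD s : A s -> `|P s| <= D * `|s|.
  move=> As; apply: le_trans (ler_normD _ _) _.
  have h := norm_comb_le (fun i _ => coef_le bx i (AX _ As)) y2.
  apply: le_trans (lerD (lexx _) h) _; rewrite /D; lra.
have DP s : A s -> `|s| <= D * `|P s|.
  move=> As; rewrite -[s in leLHS](addrK (comb a (coef x s) y)).
  apply: le_trans (ler_normB _ _) _.
  have h : `|comb a (coef x s) y| <= a%:R * (4 * `|P s| * 2).
    apply: norm_comb_le y2 => i ia.
    by rewrite -coefP_m//; apply: coef_le => //; apply: XP.
  apply: le_trans (lerD (lexx _) h) _; rewrite /D; lra.
exists (fun s => D *: P s); split.
- move=> r s t /AX Xs /AX Xt.
  have -> : P (r *: s + t) = r *: P s + P t.
    rewrite /P scalerDr addrACA -combZ -combD; congr (_ + _).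
    by apply: eq_comb => // i _; rewrite coef_lin.
  by rewrite scalerDr !scalerA mulrC.
- move=> s As; apply: (subspaceZ _ (closed_span_subspace _)).
  by apply: tailP => //; [exact: XP|move=> i im; exact: coefP_lt].
- move=> s As; have D0 : 0 <= D by apply: le_trans D1.
  rewrite normrZ ger0_norm//; split; first exact: DP.
  by rewrite -mulrA ler_wpM2l//; apply: PD.
Qed.

Lemma not_tight_tails : ~ tight_with_constants x ->
  exists (Y : completeNormedModType R) (K : R),
    [/\ inf_dim_subspace [set: Y], 0 <= K & forall m, emb K [set: Y] (tail x m)].
Proof.
move=> /not_tight_gap[Y [K [a [iY gap]]]].
pose D : R := (1 + 8 * a%:R) * (1 + 8 * a%:R).
have D0 : 0 <= D by rewrite mulr_ge0// addr_ge0// mulr_ge0.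
exists Y, (D * K%:R); split=> //; first exact: mulr_ge0.
move=> m.
have sY : is_subspace [set: Y] by split.
have gapm := embeds_emb sY (closed_span_subspace _) (gap _ (leq_addr (maxn a m) a)).
have [T [Tl Tt TK]] := emb_trans D0 gapm (emb_shift (leq_maxl a m)).
exists T; split=> // y _; apply: (@tail_sub _ _ x m (maxn a m)); first exact: leq_maxr.
exact: Tt.
Qed.

End Tightness.

(** * Local minimality *)

Section LocalMinimality.
Variables (R : realType).

(** Completeness of [Y] makes the range closed. *)
Lemma inf_dim_image (Y : completeNormedModType R) (V : normedModType R)
    (K : R) (T : Y -> V) :
  linear_on [set: Y] T -> (forall y, `|y| <= `|T y| /\ `|T y| <= K * `|y|) ->
  inf_dim_subspace [set: Y] -> inf_dim_subspace (range T).
Proof.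
move=> Tl TK /inf_dimP[sY _ iY]; apply/inf_dimP.
have sT : is_subspace (range T).
  split; first by exists 0 => //; apply: (linear_on0 Tl).
  by move=> r _ _ [y _ <-] [z _ <-]; exists (r *: y + z) => //; rewrite Tl.
split=> //.
- apply/closed_distP => x /closure_distP/closure_seq[u [uT ux]].
  have /choice[w wE] : forall n, exists y, T y = u n.
    by move=> n; have [y _] := uT n; exists y.
  have [n m|y wy] := cvg_lipschitz (w := w) (C := 1) ux.
    by rewrite mul1r -!wE -(linear_onB Tl)//; case: (TK (w n - w m)).
  exists y => //; apply/eqP; rewrite -subr_eq0 -normr_le0.
  have -> : 0 = K * `|y - y| by rewrite subrr normr0 mulr0.
  apply: (@cvg_norm_le _ _ _ (fun n => T y - u n) (fun n => y - w n)).
  + by apply: cvgB => //; apply: cvg_cst.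
  + by apply: cvgB => //; apply: cvg_cst.
  + by move=> n; rewrite -wE -(linear_onB Tl)//; case: (TK (y - w n)).
- move=> /finite_dimE[d [v TE]]; apply: iY; apply/finite_dimE.
  have /choice[w wE] : forall i, exists y, (i < d)%N -> T y = v i.
    move=> i; have [id|_] := ltnP i d; last by exists 0.
    by have := fspan_gen v id; rewrite -TE => -[y _ <-]; exists y.
  exists d, w; apply/seteqP; split=> // y _.
  have : range T (T y) by exists y.
  rewrite TE => -[c cE]; exists c; apply/eqP.
  rewrite -subr_eq0 -normr_le0.
  have [+ _] := TK (y - comb d c w); rewrite (linear_onB Tl)//.
  rewrite (linear_on_comb _ Tl)// (@eq_comb _ _ d c c (T \o w) v)//.
  by rewrite -cE subrr normr0.
Qed.

(** Finite systems of the copy [range T] of [U] embed in [B] through [U]. *)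
Lemma emb_seq_transfer (U V W : normedModType R) (K : R) (T : U -> V) d v
    (B : set W) : 0 <= K ->
  linear_on [set: U] T -> (forall y, `|y| <= `|T y| /\ `|T y| <= K * `|y|) ->
  is_subspace B -> emb K [set: U] B -> (forall i, (i < d)%N -> range T (v i)) ->
  emb_seq (K * K) d v B.
Proof.
move=> K0 Tl TK sB [S [Sl SB SK]] vT.
have sU : is_subspace [set: U] by [].
have /choice[y yE] : forall i, exists y, (i < d)%N -> T y = v i.
  move=> i; have [id|_] := ltnP i d; last by exists 0.
  by have [y _ <-] := vT _ id; exists y.
exists (fun i => K *: S (y i)); split=> [i id|c].
  by apply: subspaceZ => //; apply: SB.
have -> : comb d c v = T (comb d c y).
  by rewrite (linear_on_comb _ Tl)//; apply: eq_comb => // i id; rewrite /= yE.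
rewrite combZr normrZ ger0_norm// -(linear_on_comb (v := y) _ Sl)//.
have [t1 t2] := TK (comb d c y); have [s1 s2] := SK (comb d c y) I.
split; first by apply: le_trans t2 _; apply: ler_wpM2l.
rewrite -mulrA ler_wpM2l//; apply: le_trans s2 _; exact: ler_wpM2l.
Qed.

Variable E : normedModType R.

Definition rat_system (u : nat -> E) (q : seq (seq rat)) i := rat_vector u (nth [::] q i).

Lemma rat_system_dense u d v C : basic u -> 0 <= C -> coef_bound d v C ->
  (forall i, (i < d)%N -> closed_span (range u) (v i)) ->
  exists q, size q = d /\ equivalent_systems d v (rat_system u q).
Proof.
move=> bu C0 bC uv.
(* perturbations below [1 / (2 d C)] are harmless; [+ 1] covers [d C = 0] *)
pose e : R := (2 * (d%:R * C + 1))^-1.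
have e0 : 0 < e by rewrite invr_gt0 mulr_gt0// ltr_wpDl// mulr_ge0.
have /choice[r rP] : forall i, exists r, (i < d)%N -> `|v i - rat_vector u r| <= e.
  move=> i; have [id|_] := ltnP i d; last by exists [::].
  by have [r] := rat_vector_dense bu (uv _ id) e0; exists r.
exists (mkseq r d); split; first by rewrite size_mkseq.
apply: equivalent_systems_perturb bC _ _ => [i id|].
  by rewrite /rat_system nth_mkseq//; apply: rP.
have dC : 0 <= d%:R * C by rewrite mulr_ge0.
rewrite mulrA /e invfM mulrCA ler_piMr//.
by rewrite ler_pdivrMr ?mul1r ?lerDl// ltr_wpDl.
Qed.

(** [n] ranges over the codes of pairs [(q, C)]. In the second alternative all
    subspaces contain a copy of [q] with the same constant [C], which is what
    makes the constant of local minimality uniform. *)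
Definition decided (u : nat -> E) n (W : set E) :=
  if unpickle n is Some (q, C) then
    ~ emb_seq (C : nat)%:R (size q) (rat_system u q) W \/
    forall Z, inf_dim_subspace Z -> Z `<=` W ->
      emb_seq C%:R (size q) (rat_system u q) Z
  else True.

Lemma decidable_below u n W : inf_dim_subspace W ->
  exists W', [/\ inf_dim_subspace W', W' `<=` W & decided u n W'].
Proof.
move=> iW; rewrite /decided; case: unpickle => [[q C]|]; last by exists W; split.
have [[Z [iZ ZW nZ]]|noZ] := pselect (exists Z, [/\ inf_dim_subspace Z, Z `<=` W &
    ~ emb_seq C%:R (size q) (rat_system u q) Z]).
  by exists Z; split=> //; left.
exists W; split=> //; right=> Z iZ ZW; apply: contrapT => nZ.
by apply: noZ; exists Z.
Qed.

(** A finite-dimensional subspace of the copy of [Y] embeds in all tails, which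
    excludes the first alternative of [decided] for a rational system near it. *)
Lemma not_tight_locally_minimal (u x : nat -> E) (W : nat -> set E) :
  basic u -> basic x -> W 0%N = closed_span (range u) ->
  (forall n m, (n <= m)%N -> W n (x m)) ->
  (forall n, inf_dim_subspace (W n) /\ decided u n (W n.+1)) ->
  ~ tight_with_constants x ->
  exists2 Y0 : set E, inf_dim_subspace Y0 & locally_minimal Y0.
Proof.
move=> bu bx W0 Wx WP /(not_tight_tails bx)[Y [K [iY K0 Yt]]].
have tailW n : tail x n `<=` W n.
  have /inf_dimP[sW cW _] := proj1 (WP n).
  by apply: closed_span_sub => // _ [k /= nk <-]; apply: Wx.
have [T [Tl TX TK]] := Yt 0%N.
have {}TK y : `|y| <= `|T y| /\ `|T y| <= K * `|y| by exact: TK.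
have TrX : range T `<=` closed_span (range x).
  by move=> _ [y _ <-]; apply: closed_span_image_sub; apply: TX.
exists (range T); first exact: inf_dim_image Tl TK iY.
pose C := (Num.truncn (4 * (K * K))).+1.
have CK : 4 * (K * K) <= C%:R by apply: ltW; apply: truncnS_gt.
exists (4 * C%:R) => Z iZ ZT F [/subspaceE sF /finite_dimE[d' [v' FE]]] FT.
have [d [v [B [spanE B0 bB]]]] := fspan_basis d' v'.
rewrite {}FE -{}spanE in sF FT *.
have vT i : (i < d)%N -> range T (v i) by move=> id; apply/FT/fspan_gen.
have [q [qd vq]] : exists q, size q = d /\ equivalent_systems d v (rat_system u q).
  apply: rat_system_dense bu B0 bB _ => i id; rewrite -W0; apply: tailW.
  by have [y _ <-] := vT _ id; apply: TX.
have embt m : emb_seq C%:R d (rat_system u q) (tail x m).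
  apply: emb_seq_le CK _; apply: (emb_seq_equivalent _ _ vq).
  - exact: mulr_ge0.
  - exact: closed_span_subspace.
  - by apply: emb_seq_transfer Tl TK _ _ _ => //; exact: closed_span_subspace.
pose n := pickle (q, C).
have [Z' [iZ' Z'Z Z'n]] := inf_dim_tail bx n.+1 iZ (subset_trans ZT TrX).
have /inf_dimP[sZ _ _] := iZ.
have := proj2 (WP n); rewrite /decided pickleK qd => -[nW|allZ].
  by case: nW; apply: emb_seq_sub (embt n.+1); exact: tailW.
have {}allZ := allZ _ iZ' (subset_trans Z'n (tailW _)).
apply: emb_embeds => //.
apply: emb_seq_emb => //.
apply: (emb_seq_equivalent _ sZ (equivalent_systems_sym vq)) => //.
exact: emb_seq_sub allZ.
Qed.

Lemma locally_minimal_sub (A B : set E) : A `<=` B ->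
  locally_minimal B -> locally_minimal A.
Proof.
move=> AB [K BK]; exists K => Z iZ ZA F fF FA.
by apply: BK => //; [exact: subset_trans AB|exact: subset_trans AB].
Qed.

Lemma exists_basic (W : set E) : inf_dim_subspace W ->
  exists2 x : nat -> E, basic x & closed_span (range x) `<=` W.
Proof.
move=> iW; have [n Z iZ|S [x [bx S0 Sx _]]] := diagonal_basic (P := fun _ _ => True) iW.
  by exists Z; split.
exists x => //; have /inf_dimP[sW cW _] := iW.
by apply: closed_span_sub => // _ [k _ <-]; rewrite -S0; apply: Sx.
Qed.

End LocalMinimality.

Theorem theorem1p2 (R : realType) (E : completeNormedModType R) :
  inf_dim_subspace [set: E] ->
  exists (X : set E) (e : nat -> E),
    [/\ inf_dim_subspace X,
        schauder_basis X e
      & tight_with_constants e \/ locally_minimal X].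
Proof.
move=> iE.
have [u bu _] := exists_basic iE.
have [W [x [bx W0 Wx WP]]] := diagonal_basic (basic_inf_dim bu) (@decidable_below _ _ u).
have [tx|ntx] := pselect (tight_with_constants x).
  exists (closed_span (range x)), x; split; last by left.
  - exact: basic_inf_dim.
  - exact: basic_schauder.
have [Y0 iY0 lY0] := not_tight_locally_minimal bu bx W0 Wx WP ntx.
have [z bz zY0] := exists_basic iY0.
exists (closed_span (range z)), z; split.
- exact: basic_inf_dim.
- exact: basic_schauder.
- by right; apply: locally_minimal_sub lY0.
Qed.
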